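(* Let $b>a>0$, $q\ge1$, $0<s\le2$, $-1<(s-1)q\le1$, and $0\le\lambda\le1$. Then $$\begin{aligned} &\big|\lambda A(a^s,b^s)+(1-\lambda)A^s(a,b)-L_s^s(a,b)\big|\\ &\le\frac{(b-a)s}4\left[\frac1{s(s+1)}\right]^{1/q}\left(\tfrac12-\lambda+\lambda^2\right)^{1-1/q}\\ &\quad\times\Big\{\Big[\big(2(1-\lambda)^{s+1}+(s+1)\lambda-1\big)a^{(s-1)q}+\big(2\lambda^{s+1}-(s+1)\lambda+s\big)A^{(s-1)q}(a,b)\Big]^{1/q}\\ &\qquad+\Big[\big(2\lambda^{s+1}-(s+1)\lambda+s\big)A^{(s-1)q}(a,b)+\big(2(1-\lambda)^{s+1}+(s+1)\lambda-1\big)b^{(s-1)q}\Big]^{1/q}\Big\}. \end{aligned}$$ In particular, if $q=1$, then $$\begin{aligned} &\big|\lambda A(a^s,b^s)+(1-\lambda)A^s(a,b)-L_s^s(a,b)\big|\\ &\le\frac{(b-a)s}{2s(s+1)}\Big\{\big[2(1-\lambda)^{s+1}+(s+1)\lambda-1\big]A(a^{s-1},b^{s-1})+\big[2\lambda^{s+1}+s-(s+1)\lambda\big]A^{s-1}(a,b)\Big\}. \end{aligned}$$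
   Context: For $a,b>0$, $A(a,b)=\frac{a+b}2$ is the arithmetic mean. The generalized logarithmic mean is, for $a\ne b$, $L_s(a,b)=\left[\frac{b^{s+1}-a^{s+1}}{(s+1)(b-a)}\right]^{1/s}$ if $s\ne0,-1$; $L_{-1}(a,b)=\frac{b-a}{\ln b-\ln a}$; $L_0(a,b)=\frac1e\left(\frac{b^b}{a^a}\right)^{1/(b-a)}$; and $L_s(a,a)=a$. Powers are written $A^r(a,b)=(A(a,b))^r$ and $L_s^s(a,b)=(L_s(a,b))^s$. *)

(* Defs.v *)
From HB Require Import structures.
From mathcomp Require Import all_boot all_order all_algebra.
From mathcomp Require Import all_classical all_reals all_analysis.

Set Implicit Arguments.
Unset Strict Implicit.
Unset Printing Implicit Defensive.

Import Order.TTheory GRing.Theory Num.Theory.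
Local Open Scope ring_scope.

(* Real powers are [powR]. Its convention 0 `^ r = 0 for r != 0 matters: the
   bases lambda and 1 - lambda (with exponent s + 1) may vanish. *)

Definition arith_mean (R : realType) (a b : R) : R := (a + b) / 2.

(* The means are only meaningful for 0 < a and 0 < b. *)
Definition gen_log_mean (R : realType) (s a b : R) : R :=
  if a == b then a
  else if s == -1 then (b - a) / (ln b - ln a)
  else if s == 0 then
    (expR 1)^-1 * ((b `^ b) / (a `^ a)) `^ (b - a)^-1
  else
    ((b `^ (s + 1) - a `^ (s + 1)) / ((s + 1) * (b - a))) `^ s^-1.

(* Main.v *)
Require Import Defs.
From HB Require Import structures.
From mathcomp Require Import all_boot all_order all_algebra.
From mathcomp Require Import all_classical all_reals all_analysis.
From mathcomp Require Import ring lra.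

Import Order.TTheory GRing.Theory Num.Theory.
Import numFieldNormedType.Exports.
Local Open Scope ring_scope.

(* With f x = x `^ s, integrating (c - t) * f' (m + t * (e - m)) by parts on [0, 1],
   where c = 1 - lambda and m is the midpoint, gives the deviation on the
   half-interval between m and an endpoint e; the theorem averages e = a and e = b.
   By Hoelder's inequality with weight |c - t|, it suffices to integrate
   |c - t| * x `^ ((s - 1) * q), and x `^ ((s - 1) * q), as a function of
   x = t * e + (1 - t) * m, is dominated by
   t `^ (s - 1) * e `^ r + (1 - t) `^ (s - 1) * m `^ r with r = (s - 1) * q.
   Since t `^ (s - 1) is unbounded at 0 when s < 1, integrals are replaced by
   increments of explicit primitives, compared by the mean value theorem on
   [0, c] and [c, 1]; Hoelder's inequality is replaced by its pointwise tangent
   form, optimized over the parameter K. *)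

(** * Comparison of increments, and continuity of powers up to 0 *)

(** Both [g - f] and [g + f] have nonnegative derivative, so the mean value theorem makes both
    increments nonnegative. *)
Lemma norm_increment_le (R : realType) (f g df dg : R -> R) (a b : R) :
  a <= b ->
  {within `[a, b], continuous f}%classic ->
  {within `[a, b], continuous g}%classic ->
  (forall x, x \in `]a, b[ -> is_derive x 1 f (df x)) ->
  (forall x, x \in `]a, b[ -> is_derive x 1 g (dg x)) ->
  (forall x, x \in `]a, b[ -> `|df x| <= dg x) ->
  `|f b - f a| <= g b - g a.
Proof.
rewrite le_eqVlt => /predU1P[-> |ab cf cg Df Dg dfg].
  by rewrite !subrr normr0.
have cgBf : {within `[a, b], continuous (g - f)%R}%classic.
  by move=> x; exact: continuousB (cg x) (cf x).
have cgDf : {within `[a, b], continuous (g + f)%R}%classic.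
  by move=> x; exact: continuousD (cg x) (cf x).
have [|x xab eqB] := @MVT _ (g - f) (fun x => dg x - df x) _ _ ab _ cgBf.
  by move=> x xab; apply: is_deriveB; [exact: Dg|exact: Df].
have [|y yab eqD] := @MVT _ (g + f) (fun x => dg x + df x) _ _ ab _ cgDf.
  by move=> y yab; apply: is_deriveD; [exact: Dg|exact: Df].
move: (dfg _ xab) (dfg _ yab); rewrite !ler_norml => /andP[_ Bx] /andP[Dy _].
have ab0 : 0 <= b - a by rewrite subr_ge0 ltW.
have hB : 0 <= (g - f) b - (g - f) a by rewrite eqB mulr_ge0// subr_ge0.
have hD : 0 <= (g + f) b - (g + f) a.
  by rewrite eqD mulr_ge0// addrC -lerBlDr sub0r.
move: hB hD; rewrite !fctE => hB hD.
by apply/andP; split; lra.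
Qed.

Lemma continuous_norm_powR (R : realType) (s : R) : 0 < s ->
  continuous (fun t : R => `|t| `^ s).
Proof.
move=> s0 x; have [->|x0] := eqVneq x 0.
  rewrite /continuous_at normr0 powR0 ?gt_eqF//.
  apply/cvgrPdist_le => e e0; near=> t.
  rewrite sub0r normrN ger0_norm ?powR_ge0//.
  (* Writing [e] as an s-th power gives the radius e^(1/s) and leaves only monotonicity of
     powers. *)
  have -> : e = (e `^ s^-1) `^ s by rewrite -powRrM mulVf ?gt_eqF// powRr1// ltW.
  rewrite ge0_ler_powR ?nnegrE ?powR_ge0 ?(ltW s0)//.
  near: t; exists (e `^ s^-1) => [|t]; first exact: powR_gt0.
  by rewrite /= sub0r normrN => /ltW.
have h1 : {for x, continuous (fun t : R => `|t|)} by exact: norm_continuous.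
have h2 : {for `|x|, continuous (fun y : R => y `^ s)}.
  apply: differentiable_continuous; apply/derivable1_diffP.
  by apply: derivable_powR; rewrite in_itv/= normr_gt0 x0.
exact: (@continuous_comp R R R _ _ x h1 h2).
Unshelve. all: by end_near. Qed.

(** * Explicit majorants for integrals against |c - t| *)

Section kernel_primitive.
Context {R : realType}.
Variables (s c al b1 b2 : R).

(** Antiderivative of (c - t)(al + b1 t^(s-1) + b2 (1-t)^(s-1)) on ]0, 1[. For s > 0 it is
    continuous up to 0 and 1, even where the integrand blows up. *)
Definition kernel_primitive (t : R) : R :=
  al * (c * t - t ^+ 2 / 2) + b1 * (t `^ s * (c / s - t / (s + 1)))
  + b2 * ((1 - t) `^ s * ((1 - c) / s - (1 - t) / (s + 1))).

Hypothesis s0 : 0 < s.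

Lemma continuous_kernel_primitive :
  {within `[(0 : R)%R, (1 : R)%R], continuous kernel_primitive}%classic.
Proof.
(* [x `^ s] is the junk value 1 for x < 0, hence discontinuous at 0 on the real
   line; absolute values repair this without changing it on [0, 1]. *)
apply: (@subspace_eq_continuous _ _ _ (fun t : R =>
  al * (c * t - t ^+ 2 / 2) + b1 * (`|t| `^ s * (c / s - t / (s + 1)))
  + b2 * (`|1 - t| `^ s * ((1 - c) / s - (1 - t) / (s + 1))))).
  move=> t; rewrite inE/= in_itv/= => /andP[t0 t1].
  by rewrite /from_subspace /kernel_primitive !ger0_norm ?subr_ge0.
apply: continuous_subspaceT => t.
have Ck (k : R) : {for t, continuous (cst k : R -> R)} by exact: cvg_cst.
have C1 : {for t, continuous (id : R -> R)} by exact: cvg_id.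
have Cu := continuousB (Ck 1) C1.
have Ct := continuous_norm_powR _ _ s0 t.
have Cut := continuous_comp Cu (continuous_norm_powR _ _ s0 _).
exact: (continuousD (continuousD
  (continuousM (Ck al) (continuousB (continuousM (Ck c) C1)
    (continuousM (continuousM C1 C1) (Ck 2^-1))))
  (continuousM (Ck b1) (continuousM Ct (continuousB (Ck (c / s))
    (continuousM C1 (Ck (s + 1)^-1))))))
  (continuousM (Ck b2) (continuousM Cut (continuousB (Ck ((1 - c) / s))
    (continuousM Cu (Ck (s + 1)^-1)))))).
Qed.

Lemma is_derive_kernel_primitive (t : R) : 0 < t < 1 ->
  is_derive t 1 kernel_primitive
    ((c - t) * (al + b1 * t `^ (s - 1) + b2 * (1 - t) `^ (s - 1))).
Proof.
move=> /andP[t0 t1]; have u0 : 0 < 1 - t by rewrite subr_gt0.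
have D1 := is_derive_id t (1 : R).
have Dc k := is_derive_cst (k : R) t (1 : R).
have Du := is_deriveB (Dc 1) D1.
have Dt := @is_derive1_powR R s t t0.
have Dut := @is_derive1_comp R (fun x : R => x `^ s) (cst 1 - id) t _ _
  (@is_derive1_powR R s _ u0) Du.
apply: (is_derive_eq (is_deriveD (is_deriveD
  (is_deriveM (Dc al) (is_deriveB (is_deriveM (Dc c) D1)
    (is_deriveM (is_deriveX 2 D1) (Dc 2^-1))))
  (is_deriveM (Dc b1) (is_deriveM Dt (is_deriveB (Dc (c / s))
    (is_deriveM D1 (Dc (s + 1)^-1))))))
  (is_deriveM (Dc b2) (is_deriveM Dut (is_deriveB (Dc ((1 - c) / s))
    (is_deriveM Du (Dc (s + 1)^-1))))))).
rewrite !fctE /= /GRing.scale/=.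
rewrite -(mulr_powRB1 (ltW t0) s0) -(mulr_powRB1 (ltW u0) s0).
have s1 : s + 1 != 0 by rewrite gt_eqF// addr_gt0.
by field; rewrite s1 gt_eqF.
Qed.
End kernel_primitive.

(* The integral of |c - t| * t `^ (s - 1) over [0, 1], for c in [0, 1]. *)
Definition kernel_moment {R : realType} (s c : R) : R :=
  (2 * c `^ (s + 1) - (s + 1) * c + s) / (s * (s + 1)).

(** The factor [c - t] changes sign at [c], so [G] is compared with the primitive [P] on [0, c] and
    with [- P] on [c, 1]; the bound is 2 P(c) - P(0) - P(1). *)
Lemma kernel_increment_le (R : realType) (s c al b1 b2 : R) (G y : R -> R) :
  0 < s -> 0 <= c <= 1 ->
  {within `[(0 : R)%R, (1 : R)%R], continuous G}%classic ->
  (forall t : R, 0 < t < 1 -> is_derive t 1 G ((c - t) * y t)) ->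
  (forall t : R, 0 < t < 1 ->
    `|y t| <= al + b1 * t `^ (s - 1) + b2 * (1 - t) `^ (s - 1)) ->
  `|G 1 - G 0| <= al * (1 / 2 - c + c ^+ 2)
    + b1 * kernel_moment s c + b2 * kernel_moment s (1 - c).
Proof.
move=> s0 /andP[c0 c1] cG DG yle.
pose P := kernel_primitive s c al b1 b2.
have cP : {within `[(0 : R)%R, (1 : R)%R], continuous P}%classic.
  exact: continuous_kernel_primitive.
pose k (t : R) := al + b1 * t `^ (s - 1) + b2 * (1 - t) `^ (s - 1).
have DP : forall t : R, 0 < t < 1 -> is_derive t 1 P ((c - t) * k t) := is_derive_kernel_primitive s c al b1 b2 s0.
have sub0c : (`[(0 : R)%R, c] `<=` `[(0 : R)%R, (1 : R)%R])%classic.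
  by move=> t /=; rewrite !in_itv/= => /andP[-> /le_trans]; exact.
have subc1 : (`[c, (1 : R)%R] `<=` `[(0 : R)%R, (1 : R)%R])%classic.
  by move=> t /=; rewrite !in_itv/= => /andP[/(le_trans c0) -> ->].
have in0c (t : R) : t \in `]0, c[ -> 0 < t < 1.
  by rewrite in_itv/= => /andP[-> /lt_le_trans]; exact.
have inc1 (t : R) : t \in `]c, 1[ -> 0 < t < 1.
  by rewrite in_itv/= => /andP[/(le_lt_trans c0) -> ->].
have le0c : `|G c - G 0| <= P c - P 0.
  apply: (@norm_increment_le R G P (fun t => (c - t) * y t)
    (fun t => (c - t) * k t) 0 c c0).
  - exact: continuous_subspaceW sub0c cG.
  - exact: continuous_subspaceW sub0c cP.
  - by move=> t /in0c; exact: DG.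
  - by move=> t /in0c; exact: DP.
  move=> t tc; have t01 := in0c _ tc; move: tc; rewrite in_itv/= => /andP[_ tc].
  have ct0 : 0 <= c - t by rewrite subr_ge0 ltW.
  by rewrite normrM (ger0_norm ct0) ler_wpM2l// yle.
have lec1 : `|G 1 - G c| <= (- P) 1 - (- P) c.
  apply: (@norm_increment_le R G (- P) (fun t => (c - t) * y t)
    (fun t => - ((c - t) * k t)) c 1 c1).
  - exact: continuous_subspaceW subc1 cG.
  - have cP1 := continuous_subspaceW subc1 cP.
    by move=> t; exact: continuousN (cP1 t).
  - by move=> t /inc1; exact: DG.
  - by move=> t /inc1 t01; exact: is_deriveN (DP _ t01).
  move=> t tc; have t01 := inc1 _ tc; move: tc; rewrite in_itv/= => /andP[tc _].
  have ct0 : c - t <= 0 by rewrite subr_le0 ltW.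
  by rewrite normrM (ler0_norm ct0) -mulNr ler_wpM2l ?oppr_ge0// yle.
have -> : G 1 - G 0 = (G 1 - G c) + (G c - G 0) by ring.
apply: (le_trans (ler_normD _ _)); apply: (le_trans (lerD lec1 le0c)).
have s1 : s + 1 != 0 by rewrite gt_eqF// addr_gt0.
have s0' : s != 0 by rewrite gt_eqF.
rewrite le_eqVlt; apply/orP; left; apply/eqP.
rewrite !fctE /P /kernel_primitive /kernel_moment.
have pS (x : R) : 0 <= x -> x `^ (s + 1) = x * x `^ s.
  by move=> x0; rewrite -(@mulr_powRB1 _ x (s + 1)) ?addrK ?addr_gt0.
(* The value 0^s = 0 removes the [b1] term of P(0) and the [b2] term of P(1). *)
rewrite !pS ?subr_ge0// !subrr !subr0 powR0// powR1.
by field; rewrite s1 s0'.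
Qed.

(** * Pointwise inequalities for powers *)

Lemma powR_conv_le (R : realType) (s r t e m : R) :
  0 < t < 1 -> 0 < e -> 0 < m -> r <= 1 ->
  (0 <= s - 1 <= r) || (r <= 0) && (s - 1 <= 0) ->
  (m + t * (e - m)) `^ r
    <= t `^ (s - 1) * e `^ r + (1 - t) `^ (s - 1) * m `^ r.
Proof.
move=> /andP[t0 t1] e0 m0 r1.
have u0 : 0 < 1 - t by rewrite subr_gt0.
have u1 : 1 - t < 1 by rewrite gtrBl.
have -> : m + t * (e - m) = t * e + (1 - t) * m by ring.
have te0 := mulr_gt0 t0 e0; have um0 := mulr_gt0 u0 m0.
set x := t * e + (1 - t) * m.
have x0 : 0 < x by rewrite addr_gt0.
have xr0 : 0 <= x `^ r by exact: powR_ge0.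
move=> /orP[/andP[s1 sr]|/andP[r0 s1]].
(* Subadditivity for 0 <= r <= 1: the shares t e / x and (1-t) m / x sum to 1, and raising a share
   in ]0, 1] to the power r does not decrease it. Then t^r <= t^(s-1) because s - 1 <= r. *)
- have frac z : 0 < z -> z <= x -> (z / x) * x `^ r <= z `^ r.
    move=> z0 zx; have -> : z `^ r = (z / x) `^ r * x `^ r.
      rewrite -powRM ?divr_ge0 ?(ltW x0) ?(ltW z0)//.
      by rewrite divfK ?gt_eqF.
    apply: ler_wpM2r => //; apply: ger1_powR => //.
    by rewrite divr_gt0//= ler_pdivrMr// mul1r.
  have tx : t * e <= x by rewrite lerDl ltW.
  have ux : (1 - t) * m <= x by rewrite lerDr ltW.
  have -> : x `^ r = (t * e / x) * x `^ r + ((1 - t) * m / x) * x `^ r.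
    by rewrite -mulrDl -mulrDl divff ?mul1r// gt_eqF.
  apply: lerD.
    apply: (le_trans (frac _ te0 tx)); rewrite powRM ?(ltW t0) ?(ltW e0)//.
    by rewrite ler_wpM2r ?powR_ge0// ger_powR// t0 ltW.
  apply: (le_trans (frac _ um0 ux)); rewrite powRM ?(ltW u0) ?(ltW m0)//.
  by rewrite ler_wpM2r ?powR_ge0// ger_powR// u0 ltW.
- have ge1 z : 0 < z -> z < 1 -> 1 <= z `^ (s - 1).
    by move=> z0 z1; rewrite -[leLHS](powRr0 z) ger_powR// z0 ltW.
  have anti z : 0 < z -> z <= x -> x `^ r <= z `^ r.
    move=> z0 zx; rewrite -(opprK r) !(powRN _ (- r)) lef_pV2 ?posrE ?powR_gt0//.
    by apply: ge0_ler_powR; rewrite ?oppr_ge0 ?nnegrE ?(ltW z0) ?(ltW x0).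
  (* As x is at least the smaller of [e] and [m] and the power r <= 0 is nonincreasing, the term of
     that smaller point suffices: its coefficient is at least 1. *)
  have [em|me] := leP e m.
    have ex : e <= x by rewrite /x; nra.
    apply: (le_trans (anti _ e0 ex)).
    rewrite -[leLHS]addr0 lerD ?mulr_ge0 ?powR_ge0//.
    by rewrite ler_peMl ?powR_ge0// ge1.
  have mx : m <= x by rewrite /x; nra.
  apply: (le_trans (anti _ m0 mx)).
  rewrite -[leLHS]add0r lerD ?mulr_ge0 ?powR_ge0//.
  by rewrite ler_peMl ?powR_ge0// ge1.
Qed.

(** Young's inequality for the product of y / K and 1. As a function of u = y^q, the right side is
    the tangent to u^(1/q) at u = K^q. The case q = 1, whose conjugate exponent is infinite, is
    treated apart. *)
Lemma le_powR_tangent (R : realType) (q y K : R) : 1 <= q -> 0 <= y -> 0 < K ->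
  y <= K * (1 - q^-1) + K / q / K `^ q * y `^ q.
Proof.
rewrite le_eqVlt => /predU1P[<- y0 K0|q1 y0 K0].
  rewrite !powRr1 ?(ltW K0)// invr1 subrr mulr0 add0r mulr1 divff ?gt_eqF//.
  by rewrite mul1r.
have q0 : 0 < q by rewrite (lt_trans ltr01).
have p0 : 0 < 1 - q^-1 by rewrite subr_gt0 invf_lt1.
have := @conjugate_powR _ (y / K) 1 q (1 - q^-1)^-1.
rewrite divr_ge0 ?(ltW K0)// ler01 q0 invr_gt0 p0 invrK subrKC.
move=> /(_ isT isT isT isT erefl).
rewrite mulr1 powR1 mul1r ler_pdivrMr// => /le_trans; apply.
rewrite powRM ?invr_ge0 ?(ltW K0)// -powR_inv1 ?(ltW K0)// -powRrM mulN1r powRN.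
rewrite le_eqVlt; apply/orP; left; apply/eqP.
by field; rewrite !gt_eqF ?powR_gt0.
Qed.

(** * Positivity of the kernel integrals and Hoelder's inequality *)

Lemma kernel_mass_gt0 (R : realType) (c : R) : 0 < 1 / 2 - c + c ^+ 2.
Proof. by have := sqr_ge0 (c - 1 / 2); rewrite expr2; nra. Qed.

Lemma kernel_moment_ge (R : realType) (s c d b1 b2 : R) :
  0 < s -> 0 <= c <= 1 ->
  (forall t : R, 0 < t < 1 -> d <= b1 * t `^ (s - 1) + b2 * (1 - t) `^ (s - 1)) ->
  d * (1 / 2 - c + c ^+ 2) <= b1 * kernel_moment s c + b2 * kernel_moment s (1 - c).
Proof.
move=> s0 c01 hd.
(* Compare the constant 0 with the primitive of a nonnegative kernel. *)
pose z : R -> R := cst 0.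
suff : `|z 1 - z 0| <= - d * (1 / 2 - c + c ^+ 2)
    + b1 * kernel_moment s c + b2 * kernel_moment s (1 - c).
  by rewrite subrr normr0; lra.
apply: (@kernel_increment_le R s c (- d) b1 b2 z z) => //.
- by apply: continuous_subspaceT => x; exact: cvg_cst.
- by move=> t _; rewrite mulr0; exact: is_derive_cst.
- by move=> t t01; rewrite normr0; have := hd t t01; lra.
Qed.

(** Since s - 1 <= 1, t <= t^(s-1) on ]0, 1], so the weighted sum of powers is at least min(b1, b2)
    (t + (1 - t)), a positive constant. *)
Lemma kernel_moment_gt0 (R : realType) (s c b1 b2 : R) :
  0 < s <= 2 -> 0 <= c <= 1 -> 0 < b1 -> 0 < b2 ->
  0 < b1 * kernel_moment s c + b2 * kernel_moment s (1 - c).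
Proof.
move=> /andP[s0 s2] c01 b10 b20.
pose d := Num.min b1 b2.
have d0 : 0 < d by rewrite lt_min b10.
apply: (lt_le_trans (mulr_gt0 d0 (kernel_mass_gt0 R c))).
apply: kernel_moment_ge => // t /andP[t0 t1].
have geid z : 0 < z <= 1 -> z <= z `^ (s - 1).
  by move=> z01; apply: ger1_powR => //; lra.
have tp := geid t; have up := geid (1 - t).
have {}tp : t <= t `^ (s - 1) by apply: tp; lra.
have {}up : 1 - t <= (1 - t) `^ (s - 1) by apply: up; lra.
have db1 : d <= b1 by rewrite ge_min lexx.
have db2 : d <= b2 by rewrite ge_min lexx orbT.
by nra.
Qed.

(** The choice K = (V / W)^(1/q) makes K^q = V / W, and the bound collapses to K W, which is the
    claimed product. *)
Lemma le_kernel_Hoelder (R : realType) (q J W V : R) :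
  1 <= q -> 0 < W -> 0 < V ->
  (forall K : R, 0 < K -> J <= K * (1 - q^-1) * W + K / q / K `^ q * V) ->
  J <= W `^ (1 - q^-1) * V `^ q^-1.
Proof.
move=> q1 W0 V0 HJ.
have q0 : q != 0 by rewrite gt_eqF// (lt_le_trans ltr01).
have VW0 : 0 < V / W by rewrite divr_gt0.
have K0 : 0 < (V / W) `^ q^-1 by exact: powR_gt0.
apply: (le_trans (HJ _ K0)).
rewrite -powRrM mulVf// powRr1 ?(ltW VW0)//.
have -> : W `^ (1 - q^-1) * V `^ q^-1 = (V / W) `^ q^-1 * W.
  rewrite -[in LHS](divfK (lt0r_neq0 W0) V) [in LHS]powRM ?(ltW VW0) ?(ltW W0)//.
    rewrite mulrCA -powRD ?(gt_eqF W0) ?implybT// subrK.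
  by rewrite powRr1 ?(ltW W0).
rewrite le_eqVlt; apply/orP; left; apply/eqP.
by field; rewrite q0 !gt_eqF.
Qed.

(** * The estimate on one half-interval *)

(** Result of integrating (c - t) x^(s-1) by parts, where x = m + t (e - m). *)
Definition simpson_primitive {R : realType} (s c e m t : R) : R :=
  (c - t) * ((m + t * (e - m)) `^ s / (s * (e - m)))
  + (m + t * (e - m)) `^ (s + 1) / (s * (s + 1) * (e - m) ^+ 2).

Lemma is_derive_simpson_primitive (R : realType) (s c e m t : R) :
  0 < s -> e != m -> 0 < m + t * (e - m) ->
  is_derive t 1 (simpson_primitive s c e m) ((c - t) * (m + t * (e - m)) `^ (s - 1)).
Proof.
move=> s0 em x0.
have D1 := is_derive_id t (1 : R).
have Dc k := is_derive_cst (k : R) t (1 : R).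
have Dx := is_deriveD (Dc m) (is_deriveM D1 (Dc (e - m))).
have Dp p := @is_derive1_comp R (fun x : R => x `^ p)
  (cst m + id * cst (e - m)) t _ _ (@is_derive1_powR R p _ x0) Dx.
apply: (is_derive_eq (is_deriveD
  (is_deriveM (is_deriveB (Dc c) D1) (is_deriveM (Dp s) (Dc (s * (e - m))^-1)))
  (is_deriveM (Dp (s + 1)) (Dc (s * (s + 1) * (e - m) ^+ 2)^-1)))).
rewrite !fctE /= /GRing.scale/= addrK.
have s1 : s + 1 != 0 by rewrite gt_eqF// addr_gt0.
rewrite -(mulr_powRB1 (ltW x0) s0).
have em0 : e - m != 0 by rewrite subr_eq0.
by field; rewrite s1 em0 gt_eqF.
Qed.

Lemma simpson_half_le (R : realType) (s q l e m : R) :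
  0 < s <= 2 -> 1 <= q -> (s - 1) * q <= 1 -> 0 <= l <= 1 ->
  0 < e -> 0 < m -> e != m ->
  `|l * e `^ s + (1 - l) * m `^ s
    - (m `^ (s + 1) - e `^ (s + 1)) / ((s + 1) * (m - e))|
  <= `|m - e| * s * ((1 / 2 - l + l ^+ 2) `^ (1 - q^-1)
     * (e `^ ((s - 1) * q) * kernel_moment s (1 - l)
        + m `^ ((s - 1) * q) * kernel_moment s l) `^ q^-1).
Proof.
move=> /andP[s0 s2] q1 sq1 l01 e0 m0 em.
have q0 : 0 < q by rewrite (lt_le_trans ltr01).
have c01 : 0 <= 1 - l <= 1 by lra.
set r := (s - 1) * q.
pose x (t : R) := m + t * (e - m).
have x0 (t : R) : 0 <= t <= 1 -> 0 < x t by rewrite /x => /andP[t0 t1]; nra.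
have DG (t : R) : 0 <= t <= 1 -> is_derive t 1 (simpson_primitive s (1 - l) e m)
    ((1 - l - t) * x t `^ (s - 1)).
  by move=> t01; apply: is_derive_simpson_primitive => //; exact: x0.
have cG : {within `[(0 : R)%R, (1 : R)%R],
    continuous (simpson_primitive s (1 - l) e m)}%classic.
  apply: derivable_within_continuous => t; rewrite in_itv/= => t01.
  by have [] := DG t t01.
pose V := e `^ r * kernel_moment s (1 - l) + m `^ r * kernel_moment s l.
have V0 : 0 < V.
  rewrite /V -[in X in _ < _ + X](subKr 1 l).
  by apply: kernel_moment_gt0; rewrite ?powR_gt0 ?s0.
pose J := `|simpson_primitive s (1 - l) e m 1 - simpson_primitive s (1 - l) e m 0|.
have HJ : J <= (1 / 2 - l + l ^+ 2) `^ (1 - q^-1) * V `^ q^-1.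
  apply: le_kernel_Hoelder => //; first exact: kernel_mass_gt0.
  move=> K K0; set b := K / q / K `^ q.
  have b0 : 0 <= b by rewrite !divr_ge0 ?powR_ge0// ltW.
  (* The mass 1/2 - c + c^2 is invariant under replacing c by 1 - c, so it can be read at c = 1 -
     l. *)
  have -> : K * (1 - q^-1) * (1 / 2 - l + l ^+ 2) + b * V
      = K * (1 - q^-1) * (1 / 2 - (1 - l) + (1 - l) ^+ 2)
        + b * e `^ r * kernel_moment s (1 - l)
        + b * m `^ r * kernel_moment s (1 - (1 - l)).
    by rewrite subKr /V; field; rewrite gt_eqF.
  apply: (@kernel_increment_le R s (1 - l) _ _ _ _
    (fun t => x t `^ (s - 1)) s0 c01 cG).
    by move=> t /andP[t0 t1]; apply: DG; rewrite !ltW.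
  move=> t t01; have [t0 t1] := andP t01.
  have xt0 : 0 < x t by apply: x0; rewrite !ltW.
  rewrite ger0_norm ?powR_ge0//.
  apply: (le_trans (le_powR_tangent _ _ _ _ q1 (powR_ge0 _ _) K0)).
  rewrite -powRrM -/b.
  have : x t `^ r <= t `^ (s - 1) * e `^ r + (1 - t) `^ (s - 1) * m `^ r.
    (* As q >= 1, r = (s-1) q is at least s - 1 when s >= 1, and nonpositive when s < 1. *)
    apply: powR_conv_le => //; have [s1|s1] := leP 0 (s - 1).
      by rewrite /r ler_peMr.
    by rewrite /r mulr_le0_ge0 ?(ltW s1)// ltW.
  by move=> /(ler_wpM2l b0); rewrite -/r; lra.
have me : m - e != 0 by rewrite subr_eq0 eq_sym.
(* At t = 1 the factor c - t is -l and x = e; at t = 0 it is 1 - l and x = m. This produces the two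
   weights. *)
have -> : l * e `^ s + (1 - l) * m `^ s
    - (m `^ (s + 1) - e `^ (s + 1)) / ((s + 1) * (m - e))
  = (m - e) * s * (simpson_primitive s (1 - l) e m 1 - simpson_primitive s (1 - l) e m 0).
  have s1 : s + 1 != 0 by rewrite gt_eqF// addr_gt0.
  have em0 : e - m != 0 by rewrite subr_eq0.
  rewrite /simpson_primitive mul1r mul0r addr0 subrKC.
  by field; rewrite me em0 s1 gt_eqF.
rewrite 2!normrM (gtr0_norm s0) ler_wpM2l//.
by rewrite mulr_ge0// ltW.
Qed.

(** * From the two halves to the whole interval *)

Lemma gen_log_mean_powR (R : realType) (s a b : R) : 0 < s -> 0 < a -> a < b ->
  gen_log_mean s a b `^ s = (b `^ (s + 1) - a `^ (s + 1)) / ((s + 1) * (b - a)).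
Proof.
move=> s0 a0 ab; have s1 : 0 < s + 1 by rewrite addr_gt0.
rewrite /gen_log_mean lt_eqF// gt_eqF; last by rewrite (lt_trans _ s0)// ltrN10.
rewrite gt_eqF// -powRrM mulVf ?gt_eqF// powRr1// divr_ge0//.
  rewrite subr_ge0; apply: ge0_ler_powR; rewrite ?nnegrE ?(ltW s1) ?(ltW ab)//.
    exact: ltW.
  by rewrite (le_trans (ltW a0))// ltW.
by rewrite mulr_ge0 ?(ltW s1)// subr_ge0 ltW.
Qed.

Theorem theorem4p2 (R : realType) (a b q s lambda : R)
    (ha : 0 < a) (hab : a < b) (hq : 1 <= q)
    (hs0 : 0 < s) (hs2 : s <= 2)
    (hsq1 : -1 < (s - 1) * q) (hsq2 : (s - 1) * q <= 1)
    (hl0 : 0 <= lambda) (hl1 : lambda <= 1) :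
  (`| lambda * arith_mean (a `^ s) (b `^ s)
      + (1 - lambda) * (arith_mean a b) `^ s
      - (gen_log_mean s a b) `^ s |
   <= (b - a) * s / 4 * (1 / (s * (s + 1))) `^ (1 / q)
      * (1 / 2 - lambda + lambda ^+ 2) `^ (1 - 1 / q)
      * (((2 * (1 - lambda) `^ (s + 1) + (s + 1) * lambda - 1)
            * a `^ ((s - 1) * q)
          + (2 * lambda `^ (s + 1) - (s + 1) * lambda + s)
            * (arith_mean a b) `^ ((s - 1) * q)) `^ (1 / q)
         + ((2 * lambda `^ (s + 1) - (s + 1) * lambda + s)
            * (arith_mean a b) `^ ((s - 1) * q)
          + (2 * (1 - lambda) `^ (s + 1) + (s + 1) * lambda - 1)
            * b `^ ((s - 1) * q)) `^ (1 / q)))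
  /\
  (q = 1 ->
   `| lambda * arith_mean (a `^ s) (b `^ s)
      + (1 - lambda) * (arith_mean a b) `^ s
      - (gen_log_mean s a b) `^ s |
   <= (b - a) * s / (2 * s * (s + 1))
      * ((2 * (1 - lambda) `^ (s + 1) + (s + 1) * lambda - 1)
           * arith_mean (a `^ (s - 1)) (b `^ (s - 1))
         + (2 * lambda `^ (s + 1) + s - (s + 1) * lambda)
           * (arith_mean a b) `^ (s - 1))).
Proof.
have s02 : 0 < s <= 2 by rewrite hs0.
have l01 : 0 <= lambda <= 1 by rewrite hl0.
have hb := lt_trans ha hab.
set m := arith_mean a b.
have m0 : 0 < m by rewrite /m /arith_mean; lra.
have am : a != m by rewrite lt_eqF// /m /arith_mean; lra.
have bm : b != m by rewrite gt_eqF// /m /arith_mean; lra.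
have s0 : s != 0 by rewrite gt_eqF.
have s1 : s + 1 != 0 by rewrite gt_eqF// addr_gt0.
have ab0 : b - a != 0 by rewrite subr_eq0 gt_eqF.
set r := (s - 1) * q.
set A := 2 * (1 - lambda) `^ (s + 1) + (s + 1) * lambda - 1.
set B := 2 * lambda `^ (s + 1) - (s + 1) * lambda + s.
have kA : kernel_moment s (1 - lambda) = A / (s * (s + 1)).
  by rewrite /kernel_moment /A; congr (_ / _); ring.
have kB : kernel_moment s lambda = B / (s * (s + 1)) by [].
have V0 e : 0 < e -> 0 < (A * e `^ r + B * m `^ r) / (s * (s + 1)).
  move=> e0; have := @kernel_moment_gt0 R s (1 - lambda) (e `^ r) (m `^ r) s02.
  rewrite subKr kA kB => H.
  have -> : (A * e `^ r + B * m `^ r) / (s * (s + 1)) =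
      e `^ r * (A / (s * (s + 1))) + m `^ r * (B / (s * (s + 1))).
    by field; rewrite s1.
  by apply: H; rewrite ?powR_gt0//; lra.
have half e : 0 < e -> e != m ->
    `|lambda * e `^ s + (1 - lambda) * m `^ s
      - (m `^ (s + 1) - e `^ (s + 1)) / ((s + 1) * (m - e))|
    <= `|m - e| * s * ((1 / 2 - lambda + lambda ^+ 2) `^ (1 - 1 / q)
       * ((A * e `^ r + B * m `^ r) / (s * (s + 1))) `^ (1 / q)).
  move=> e0 em; have := @simpson_half_le R s q lambda e m s02 hq hsq2 l01 e0 m0 em.
  rewrite kA kB -/r !div1r.
  suff -> : e `^ r * (A / (s * (s + 1))) + m `^ r * (B / (s * (s + 1))) =
      (A * e `^ r + B * m `^ r) / (s * (s + 1)) by [].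
  by field; rewrite s1.
have total : `|lambda * arith_mean (a `^ s) (b `^ s) + (1 - lambda) * m `^ s
      - gen_log_mean s a b `^ s|
    <= (b - a) * s / 4 * (1 / 2 - lambda + lambda ^+ 2) `^ (1 - 1 / q)
       * (((A * a `^ r + B * m `^ r) / (s * (s + 1))) `^ (1 / q)
          + ((A * b `^ r + B * m `^ r) / (s * (s + 1))) `^ (1 / q)).
  rewrite gen_log_mean_powR//.
  have ha2 := half a ha am; have hb2 := half b hb bm.
  have ma : m - a = (b - a) / 2 by rewrite /m /arith_mean; field.
  have mb : m - b = - ((b - a) / 2) by rewrite /m /arith_mean; field.
  move: ha2 hb2; rewrite ma mb normrN (@ger0_norm _ ((b - a) / 2)); last by lra.
  set X1 := (X in `|X| <= _) => hX1; set X2 := (X in `|X| <= _) => hX2.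
  (* In the average of the two halves the m^(s+1) terms cancel, leaving the integral mean over
     [a, b]. The length (b - a) / 2 and this average produce the 4. *)
  have -> : lambda * arith_mean (a `^ s) (b `^ s) + (1 - lambda) * m `^ s
      - (b `^ (s + 1) - a `^ (s + 1)) / ((s + 1) * (b - a)) = (X1 + X2) / 2.
    by rewrite /X1 /X2 /arith_mean; field; rewrite ?s1 ?ab0.
  have n2 : `|2^-1 : R| = 2^-1 by rewrite ger0_norm.
  rewrite normrM n2 ler_pdivrMr//.
  apply: (le_trans (ler_normD X1 X2)); apply: (le_trans (lerD hX1 hX2)).
  rewrite le_eqVlt; apply/orP; left; apply/eqP.
  by move: (_ `^ (1 - 1 / q)) (_ `^ (1 / q)) (_ `^ (1 / q)) => W V1 V2; field.
(* Powers are multiplicative on nonnegative factors; [V0] supplies the sign of the numerator. *)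
have split e : 0 < e -> ((A * e `^ r + B * m `^ r) / (s * (s + 1))) `^ (1 / q)
    = (1 / (s * (s + 1))) `^ (1 / q) * (A * e `^ r + B * m `^ r) `^ (1 / q).
  move=> e0; have ss0 : 0 < s * (s + 1) by rewrite mulr_gt0// addr_gt0.
  have := V0 e e0; rewrite pmulr_lgt0 ?invr_gt0// => /ltW num0.
  by rewrite -powRM ?divr_ge0 ?(ltW ss0)// !div1r [in RHS]mulrC.
split.
  apply: (le_trans total); rewrite !split// [B * _ + A * _]addrC.
  rewrite le_eqVlt; apply/orP; left; apply/eqP.
  move: (_ `^ (1 - 1 / q)) (_ `^ (1 / q)) (_ `^ (1 / q)) (_ `^ (1 / q)).
  by move=> *; field.
move=> q1; apply: (le_trans total).
(* At q = 1 the mass has exponent 0 and becomes 1; the exponents 1 then disappear because [V0] makes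
   their bases nonnegative. *)
rewrite /r q1 mulr1 divr1 subrr powRr0 mulr1.
rewrite !powRr1; last 2 first.
- by have /ltW := V0 b hb; rewrite /r q1 mulr1.
- by have /ltW := V0 a ha; rewrite /r q1 mulr1.
rewrite le_eqVlt; apply/orP; left; apply/eqP.
by rewrite /B /arith_mean; field; rewrite s1.
Qed.
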